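(* Let $X\subset\mathbb{R}$ be an interval and $(X,T,\mu)$ a probability preserving dynamical system which is exponentially mixing for $BV$ against $L^1$, and suppose the short return time estimate holds: there are $C,s>0$ such that $\mu(A(r,n))\le Cr^s$ for all $r>0$ and $n\ge1$. Let $(r_n)_n$ be a sequence of positive numbers and $h:\mathbb{N}\to(0,\infty)$ a function with $h(n)\to\infty$ such that \[ r_n\le\frac{1}{(n\log n)^{1/s}h(n)}\quad\text{and}\quad \int\mu(B(x,r_n))\,d\mu(x)\le\frac{1}{n^2h(n)} \] for all large $n$. Then $\mu(\liminf_n F_{n,r_n}^T)=0$.
   Context: $(X,T,\mu)$ is exponentially mixing for $BV$ against $L^1$ if there are $C,\theta>0$ such that for all $\psi$ of bounded variation, all $\varphi\in L^1(\mu)$ and all $n\ge0$, $\bigl|\int\psi\cdot\varphi\circ T^n\,d\mu-\int\psi\,d\mu\int\varphi\,d\mu\bigr|\le C\|\psi\|_{BV}\|\varphi\|_{L^1}e^{-\theta n}$. $A(r,n):=\{x\in X: |x-T^nx|<r\}$. For $n\in\mathbb{N}$, $r>0$: $F_{n,r}^T:=\{x\in X: |T^ix-T^jx|<r \text{ for some } 0\le i<j<n\}$; $F_{n,r_n}^T$ is this set with $r=r_n$. $B(x,r)$ is the open ball of radius $r$ about $x$. *)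

(* Defs.v *)
From HB Require Import structures.
From mathcomp Require Import all_boot all_order all_algebra.
From mathcomp Require Import all_classical all_reals all_analysis.
Set Implicit Arguments. Unset Strict Implicit. Unset Printing Implicit Defensive.
Import Order.TTheory GRing.Theory Num.Theory.
Import numFieldNormedType.Exports.
Local Open Scope classical_set_scope.
Local Open Scope ring_scope.

Section Defs.
Variable R : realType.

Definition varX (X : set R) (f : R -> R) : \bar R :=
  ereal_sup [set v | exists (n : nat) (s : nat -> R),
    (forall i, (i <= n)%N -> X (s i)) /\
    (forall i, (i < n)%N -> s i <= s i.+1) /\
    v = (\sum_(i < n) `|f (s i.+1) - f (s i)|)%:E].

Definition supX (X : set R) (f : R -> R) : \bar R :=
  ereal_sup [set `|f x|%:E | x in X].

Definition bvnorm (X : set R) (f : R -> R) : \bar R := (supX X f + varX X f)%E.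

Definition Aret (X : set R) (T : R -> R) (r : R) (n : nat) : set R :=
  [set x | X x /\ `|x - iter n T x| < r].

Definition Fset (X : set R) (T : R -> R) (n : nat) (r : R) : set R :=
  [set x | X x /\ exists i j : nat, (i < j)%N /\ (j < n)%N /\
                 `|iter i T x - iter j T x| < r].

Definition liminf_set (F : nat -> set R) : set R :=
  \bigcup_(N in [set: nat]) \bigcap_(n in [set k | (N <= k)%N]) F n.

End Defs.

(* Main.v *)
Require Import Defs.
From HB Require Import structures.
From mathcomp Require Import all_boot all_order all_algebra.
From mathcomp Require Import all_classical all_reals all_analysis.
From mathcomp Require Import measurable_realfun ring lra.
Set Implicit Arguments. Unset Strict Implicit. Unset Printing Implicit Defensive.
Import Order.TTheory GRing.Theory Num.Theory.
Import numFieldNormedType.Exports.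
Local Open Scope classical_set_scope.
Local Open Scope ring_scope.

(** It suffices that [mu (F_n) -> 0]. By invariance [mu (F_n)] is at most [n] times the sum over
    [0 < k < n] of [mu (A (r_n, k))]. For [k <= (3 / theta) ln n] the short return estimate bounds
    the summands; for larger [k], cut the line into cells of length [r_n]: a point and its [k]-th
    iterate at distance less than [r_n] lie in the same or in adjacent cells. Indicators of cells
    have BV norm at most 3, so mixing gives
    [mu (A (r, k)) <= 6 * \int mu (B (x, r)) + 9 K exp (- theta k)], where the first term arises
    because the sum of the squared cell measures is at most [\int mu (B (x, r))]. Since the error
    in the mixing estimate is linear in the measure of the target cell, it does not depend on the
    number of cells. *)

(** * Variation of interval indicators *)

(** The indicator of a ray is monotone, so along a nondecreasing sequence the sum telescopes to a
    difference of two values in {0, 1}. *)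
Lemma ler_var_indic_ray (R : realType) (a : R) (s : nat -> R) (n : nat) :
  (forall i, (i < n)%N -> s i <= s i.+1) ->
  \sum_(i < n) `|(a <= s i.+1)%R%:R - (a <= s i)%R%:R| <= 1 :> R.
Proof.
move=> hs.
have -> : \sum_(i < n) `|(a <= s i.+1)%R%:R - (a <= s i)%R%:R| =
    \sum_(0 <= i < n) ((a <= s i.+1)%R%:R - (a <= s i)%R%:R) :> R.
  rewrite big_mkord; apply: eq_bigr => i _; rewrite ger0_norm// subr_ge0 ler_nat.
  by case: (leP a (s i)) => // /le_trans -> //; exact: hs.
rewrite (telescope_sumr (fun i => (a <= s i)%R%:R))//.
by case: (a <= s n); case: (a <= s 0%N); rewrite /=; lra.
Qed.

(** The indicator is a difference of two ray indicators, each of variation at most 1; the supremum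
    contributes the remaining 1. *)
Lemma bvnorm_indic_co (R : realType) (X : set R) (a b : R) : a <= b ->
  (bvnorm X (\1_(`[a, b[%classic)) <= 3%:E)%E.
Proof.
move=> ab; have indE x : \1_(`[a, b[%classic) x = (a <= x)%R%:R - (b <= x)%R%:R :> R.
  rewrite indicE mem_setE in_itv/= ltNge.
  case: (leP b x) => [bx|_]; last by rewrite andbT subr0.
  by rewrite (le_trans ab bx) subrr.
have -> : 3%:E = (1%:E + 2%:E)%E :> \bar R by rewrite -EFinD; congr _%:E; lra.
apply: leeD; apply: ge_ereal_sup.
  move=> _ [x _ <-]; rewrite lee_fin indicE.
  by case: (_ \in _); rewrite ?normr1 ?normr0.
move=> _ [n [s [_ [hs ->]]]]; rewrite lee_fin.
rewrite (_ : 2 = 1 + 1); last by lra.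
apply: le_trans (lerD (ler_var_indic_ray a hs) (ler_var_indic_ray b hs)).
rewrite -big_split/=; apply: ler_sum => i _; rewrite !indE.
set u := (a <= _)%R%:R; set v := (b <= _)%R%:R; set u' := (a <= _)%R%:R.
set v' := (b <= _)%R%:R.
by rewrite (_ : u - v - (u' - v') = (u - u') - (v - v')) ?ler_normB//; ring.
Qed.

(** * Partition of the line into cells of length [r] *)

(* Cells are indexed by the code of the integer part, and shifted by [d], so that neighbouring
   cells get the same index [m]; cells whose [m] encodes no integer are empty. *)
Definition grid_cell (R : realType) (r : R) (d : int) (m : nat) : set R :=
  [set x | pickle (Num.floor (x / r) + d) = m].

Section grid.
Variables (R : realType) (r : R).
Hypothesis r0 : 0 < r.

(** Gives cells the form required by [bvnorm_indic_co]. If [m] encodes [j], the cell is [[(j - d) r,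
    (j - d + 1) r[]; an empty cell is written [[0, 0[], hence [a <= b] and not [a < b]. *)
Lemma grid_cellE d m : exists a b, [/\ a <= b, b - a <= r &
  grid_cell r d m = `[a, b[%classic].
Proof.
have [[j jm]|nj] := pselect (exists j : int, pickle j = m); last first.
  exists 0, 0; split; rewrite ?subr0 ?(ltW r0)//.
  apply/seteqP; split=> x /=; first by move=> xm; case: nj; eexists; exact: xm.
  by rewrite in_itv/= => /andP[x0 x1]; have := le_lt_trans x0 x1; rewrite ltxx.
exists ((j - d)%:~R * r), ((j - d + 1)%:~R * r); split.
- by rewrite ler_pM2r// ler_int lerDl.
- by rewrite -mulrBl -intrB addrAC subrr add0r mul1r.
- apply/seteqP; split=> x /=; rewrite in_itv/= -ler_pdivlMr// -ltr_pdivrMr//.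
    rewrite -floor_eq /grid_cell/= -jm => xj.
    by rewrite -(pcan_inj pickleK xj) addrK.
  by rewrite -floor_eq /grid_cell/= -jm => /eqP ->; rewrite subrK.
Qed.

Lemma measurable_grid_cell d m : measurable (grid_cell r d m).
Proof. by have [a [b [_ _ ->]]] := grid_cellE d m; exact: measurable_itv. Qed.

Lemma grid_cell_ball d m x : grid_cell r d m x -> grid_cell r d m `<=` ball x r.
Proof.
have [a [b [_ bar ->]]] := grid_cellE d m.
rewrite /= in_itv/= => /andP[ax xb] y /=; rewrite in_itv/= => /andP[ay yb].
by rewrite /ball/= ltr_norml; apply/andP; split; lra.
Qed.

Lemma trivIset_grid_cell d (X : set R) :
  trivIset setT (fun m => X `&` grid_cell r d m).
Proof.
apply/trivIsetP => i j _ _ ij; apply/seteqP; split=> x //= [[_ xi]] [_ xj].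
by move: ij; rewrite -xi -xj eqxx.
Qed.

Lemma bigcup_grid_cell d (X : set R) : \bigcup_m (X `&` grid_cell r d m) = X.
Proof.
apply/seteqP; split=> [x [m _ []]//|x Xx].
by exists (pickle (Num.floor (x / r) + d)).
Qed.

(** As [x / r] and [y / r] differ by less than 1, their floors differ by at most 1, and the shift on
    the side of [y] absorbs the difference. *)
Lemma grid_cell_close x y : `|x - y| < r ->
  exists m, [\/ grid_cell r 0 m x /\ grid_cell r (-1) m y,
                grid_cell r 0 m x /\ grid_cell r 0 m y |
                grid_cell r 0 m x /\ grid_cell r 1 m y].
Proof.
move=> xyr; exists (pickle (Num.floor (x / r))).
have : `|x / r - y / r| < 1.
  by rewrite -mulrBl normrM (gtr0_norm (_ : 0 < r^-1)) ?invr_gt0// ltr_pdivrMr ?mul1r.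
rewrite ltr_norml => /andP[h1 h2].
have := floor_itv (x / r); have := floor_itv (y / r).
set p := Num.floor (x / r); set q := Num.floor (y / r).
rewrite !intrD => /andP[q1 q2] /andP[p1 p2].
have pq : p < q + 2 by rewrite -(ltr_int R) intrD; lra.
have qp : q < p + 2 by rewrite -(ltr_int R) intrD; lra.
have : [\/ p = q - 1, p = q | p = q + 1].
  have [?|?|?] : [\/ p - q = -1, p - q = 0 | p - q = 1].
    have : p - q < 2 by lra.
    have : -2 < p - q by lra.
    by case: (p - q) => [[|[|]]|[|]]// _ _; [constructor 2|constructor 3|constructor 1].
  - by constructor 1; lra.
  - by constructor 2; lra.
  - by constructor 3; lra.
by rewrite /grid_cell/= -/p -/q addr0 => -[-> | -> | ->];
   [constructor 1|constructor 2|constructor 3]; rewrite ?addr0.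
Qed.

End grid.

(** * Cell measures against the integral of ball measures *)

Section energy.
Variables (R : realType) (mu : probability R R) (r : R).

(** The ball about [x] is the section at [x] of an open strip around the diagonal of the plane. *)
Lemma measurable_fun_ball_measure : measurable_fun setT (fun x : R => mu (ball x r)).
Proof.
pose A := [set xy : R * R | ball xy.1 r xy.2].
have mA : measurable A.
  have mf : measurable_fun setT (fun xy : R * R => `|xy.1 - xy.2|).
    apply: measurableT_comp; first exact: normr_measurable.
    by apply: measurable_funB; [exact: measurable_fst|exact: measurable_snd].
  have -> : A = setT `&` (fun xy : R * R => `|xy.1 - xy.2|) @^-1` `]-oo, r[%classic.
    by rewrite setTI; apply/seteqP; split=> -[x y]/=; rewrite in_itv.
  by apply: mf => //; exact: measurable_itv.
apply: eq_measurable_fun (measurable_fun_xsection mu mA) => x _ /=.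
by rewrite xsectionE.
Qed.

(** On [F m] the integrand is at least [mu (F m)], so integrating over [F m] already yields the
    square. *)
Lemma sum_sqr_le_ball (X : set R) (F : nat -> set R) :
  measurable X -> (forall m, measurable (F m)) -> trivIset setT F ->
  \bigcup_m F m = X -> (forall m x, F m x -> F m `<=` ball x r) ->
  (\sum_(0 <= m <oo) (mu (F m) * mu (F m)) <=
   \int[mu]_(x in X) mu (ball x r))%E.
Proof.
move=> mX mF tF FX Fball.
have mball D : measurable_fun D (fun x : R => mu (ball x r)).
  by apply: measurable_funTS; exact: measurable_fun_ball_measure.
rewrite -FX ge0_integral_bigcup//.
apply: lee_nneseries => [m _ _|m _]; first by rewrite mule_ge0.
rewrite -(@integral_cst _ _ _ mu _ (mF m)).
apply: ge0_le_integral => // x Fx.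
by apply: le_measure; rewrite ?inE//; [exact: measurable_ball|exact: Fball].
Qed.

End energy.

(** * Iterates, invariance and the union bound for [Fset] *)

Section dynamics.
Variables (R : realType) (X : set R) (T : R -> R) (mu : probability R R).
Hypothesis mX : measurable X.
Hypothesis TX : forall x, X x -> X (T x).
Hypothesis mT : measurable_fun X T.

Lemma iter_stable n x : X x -> X (iter n T x).
Proof. by move=> Xx; elim: n => //= n; exact: TX. Qed.

Lemma measurable_fun_iter n : measurable_fun X (iter n T).
Proof.
elim: n => [|n IH]; first exact: measurable_id.
rewrite (_ : iter n.+1 T = T \o iter n T)//.
by apply: (measurable_comp mX) => // _ [x Xx <-]; exact: iter_stable.
Qed.

Lemma measurable_Aret r n : measurable (Aret X T r n).
Proof.
have mf : measurable_fun X (fun x => `|x - iter n T x|).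
  apply: measurableT_comp; first exact: normr_measurable.
  apply: measurable_funB; [exact: measurable_id|exact: measurable_fun_iter].
rewrite (_ : Aret X T r n =
  X `&` (fun x => `|x - iter n T x|) @^-1` `]-oo, r[%classic).
  by apply: mf => //; exact: measurable_itv.
by apply/seteqP; split=> x/=; rewrite in_itv.
Qed.

Hypothesis muT : forall A, measurable A -> A `<=` X -> mu (X `&` T @^-1` A) = mu A.

Lemma measure_iter_preimage n A : measurable A -> A `<=` X ->
  mu (X `&` iter n T @^-1` A) = mu A.
Proof.
move=> mA AX; elim: n => [|n IH]; first by rewrite setIidr.
rewrite -IH -[RHS]muT; last by apply: subIsetl.
- congr (mu _); apply/seteqP; split=> x /=.
    by move=> [Xx]; rewrite -iterS iterSr => Ax; split=> //; split=> //; exact: TX.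
  by move=> [Xx [_]]; rewrite -iterSr.
- exact: measurable_fun_iter.
Qed.

(** Here [k] stands for the gap [j - i]. With the constraints on [i] and [k] inside the set, both
    unions run over all indices below [n], independently of each other. *)
Let ret n r i k : set R := if (0 < k)%N && (i + k < n)%N then
  X `&` iter i T @^-1` Aret X T r k else set0.

Let measurable_ret n r i k : measurable (ret n r i k).
Proof.
rewrite /ret; case: ifPn => // _.
by apply: measurable_fun_iter => //; exact: measurable_Aret.
Qed.

Let Fset_ret n r : Fset X T n r =
  \big[setU/set0]_(i < n) \big[setU/set0]_(k < n) ret n r i k.
Proof.
rewrite -(bigcup_mkord n (fun i => \big[setU/set0]_(k < n) ret n r i k)).
under eq_bigcupr do rewrite -bigcup_mkord.
apply/seteqP; split=> [x [Xx [i [j [ij [jn xij]]]]]|x].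
  exists i; first exact: ltn_trans jn.
  exists (j - i)%N.
    by apply: leq_ltn_trans jn; exact: leq_subr.
  rewrite /ret subn_gt0 ij subnKC ?(ltnW ij)// jn; split=> //.
  by split; [exact: iter_stable|rewrite -iterD subnK// ltnW].
move=> -[i _ [k /= kn]]; rewrite /ret; case: ifPn => // /andP[k0 ikn] [Xx [_]]; rewrite -iterD addnC => xij.
by split=> //; exists i, (i + k)%N; rewrite -[X in (X < _)%N]addn0 ltn_add2l.
Qed.

Lemma measurable_Fset n r : measurable (Fset X T n r).
Proof.
rewrite Fset_ret; apply: bigsetU_measurable => i _.
exact: bigsetU_measurable.
Qed.

(** Two union bounds; invariance removes [i] from each summand, whence the factor [n]. Nonnegativity
    of [a] covers the pairs for which [ret] is empty. *)
Lemma measure_Fset_le n r (a : nat -> R) : (forall k, 0 <= a k) ->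
  (forall k, (0 < k)%N -> (mu (Aret X T r k) <= (a k)%:E)%E) ->
  (mu (Fset X T n r) <= (n%:R * \sum_(k < n | (0 < k)%N) a k)%:E)%E.
Proof.
move=> a0 muA; rewrite Fset_ret.
rewrite mulr_natl -[n in _ *+ n]card_ord -sumr_const -sumEFin.
apply: (le_trans (@Boole_inequality _ _ _ mu
  (fun i => \big[setU/set0]_(k < n) ret n r i k) n _)) => [i _|].
  exact: bigsetU_measurable.
apply: lee_sum => i _.
apply: (le_trans (@Boole_inequality _ _ _ mu (ret n r i) n _)) => //.
rewrite -sumEFin [leRHS]big_mkcond/=; apply: lee_sum => k _.
rewrite /ret; case: ifPn => /=.
  move=> /andP[k0 _]; rewrite k0 measure_iter_preimage ?muA//.
    exact: measurable_Aret.
  by move=> x [].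
by rewrite measure0; case: ifPn => // _ _; rewrite lee_fin.
Qed.

(** * Return sets under exponential mixing *)

Hypothesis muX : mu X = 1%E.
Variables (K theta : R).
Hypothesis K0 : 0 < K.
Hypothesis mix : forall (psi phi : R -> R) (n : nat),
  measurable_fun X psi -> (bvnorm X psi < +oo)%E ->
  mu.-integrable X (EFin \o phi) ->
  `| Rintegral mu X (fun x => psi x * phi (iter n T x))
     - Rintegral mu X psi * Rintegral mu X phi |
  <= K * fine (bvnorm X psi) * Rintegral mu X (fun x => `|phi x|)
       * expR (- (theta * n%:R)).

(** Mixing for the indicators of [[a, b[] and [J]: the 3 bounds the BV norm of the first, and
    [mu (X]&[J)] in the error is the L1 norm of the second. *)
Lemma mixing_co n a b (J : set R) : a <= b -> measurable J ->
  (mu (X `&` (`[a, b[ `&` iter n T @^-1` J)) <=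
   mu (X `&` `[a, b[) * mu (X `&` J) +
   (3 * K * expR (- (theta * n%:R)))%:E * mu (X `&` J))%E.
Proof.
move=> ab mJ; set I := `[a, b[%classic.
have mI : measurable I by exact: measurable_itv.
have mIJ : measurable (X `&` (I `&` iter n T @^-1` J)).
  rewrite (_ : _ `&` _ = (X `&` I) `&` (X `&` iter n T @^-1` J)).
    by apply: measurableI; [exact: measurableI|exact: measurable_fun_iter].
  by apply/seteqP; split=> x /=; tauto.
have indI (A : set R) : measurable (X `&` A) ->
    Rintegral mu X (\1_A) = fine (mu (X `&` A)).
  move=> mA; rewrite /Rintegral; congr fine.
  rewrite (eq_integral (EFin \o \1_(X `&` A))).
    by rewrite integral_indic// -setIA [A `&` X]setIC setIA setIid.
  by move=> x /set_mem Xx; rewrite /= indicI/= [\1_X x]indicE mem_set// mul1r.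
have B3 := bvnorm_indic_co X ab.
have := @mix (\1_I) (\1_J) n.
have -> : (fun x => \1_I x * \1_J (iter n T x)) = \1_(I `&` iter n T @^-1` J) :> (R -> R).
  by rewrite indicI.
have -> : (fun x => `|\1_J x|) = \1_J :> (R -> R).
  by apply/funext => x; rewrite ger0_norm// indicE.
rewrite !indI//; [|exact: measurableI..].
move=> /(_ (measurable_indic mI) (le_lt_trans B3 (ltry _))) H.
have {H}/H : mu.-integrable X (EFin \o (\1_J : R -> R)).
  by apply: (integrableS measurableT) => //; exact: integrable_indic.
rewrite ler_norml => /andP[_].
rewrite -(fineK (fin_num_measure mu _ mIJ)).
have mXI : measurable (X `&` I) by exact: measurableI.
have mXJ : measurable (X `&` J) by exact: measurableI.
rewrite -(fineK (fin_num_measure mu _ mXI)) -(fineK (fin_num_measure mu _ mXJ)).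
have : 0 <= fine (mu (X `&` J)) by exact: fine_ge0.
set u := fine (mu _); set v := fine (mu _); set w := fine (mu _) => w0 H.
rewrite -!EFinM -EFinD lee_fin -lerBlDl (le_trans H)//.
have fB3 : fine (bvnorm X (\1_I)) <= 3.
  by move: B3; case: bvnorm => //= [x|]; rewrite ?lee_fin.
rewrite mulrAC ler_wpM2r// ler_wpM2r ?expR_ge0// mulrC ler_wpM2r//.
exact: ltW.
Qed.

Let err n := 3 * K * expR (- (theta * n%:R)).

Let err_ge0 n : 0 <= err n.
Proof. by rewrite /err !mulr_ge0 ?expR_ge0// ltW. Qed.

(** The points of [X] whose cell number exceeds that of their [n]-th iterate by exactly [d]. *)
Let near_pair r n d := \bigcup_m
  (X `&` (grid_cell r 0 m `&` iter n T @^-1` grid_cell r d m)).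

Let measurable_near_cell r n d m : 0 < r -> measurable
  (X `&` (grid_cell r 0 m `&` iter n T @^-1` grid_cell r d m)).
Proof.
move=> r0; rewrite setICA; apply: measurableI; first exact: measurable_grid_cell.
by apply: measurable_fun_iter => //; exact: measurable_grid_cell.
Qed.

(** Sum [mixing_co] over the cells. The main terms are split by [p * q <= p * p + q * q], and each
    family of squares is bounded by the integral, whence the 2. The errors add up to [err n] because
    the shifted cells partition [X], which has measure 1. *)
Let measure_near_pair r n d : 0 < r ->
  (mu (near_pair r n d) <= 2%:E * \int[mu]_(x in X) mu (ball x r) + (err n)%:E)%E.
Proof.
move=> r0; pose P d m := X `&` grid_cell r d m.
have mP e m : measurable (P e m).
  by apply: measurableI => //; exact: measurable_grid_cell.
have sqr_le e : (\sum_(0 <= m <oo) (mu (P e m) * mu (P e m)) <=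
    \int[mu]_(x in X) mu (ball x r))%E.
  apply: sum_sqr_le_ball => //; first exact: trivIset_grid_cell.
    exact: bigcup_grid_cell.
  by move=> m x [_ xm] y [_ ym]; exact: (grid_cell_ball r0 xm).
have sum1 : (\sum_(0 <= m <oo) mu (P d m) = 1)%E.
  rewrite -muX -[in RHS](bigcup_grid_cell r d X) measure_semi_bigcup//.
  - exact: (mP d).
  - exact: trivIset_grid_cell.
  - by rewrite bigcup_grid_cell.
pose v m := (mu (P 0%R m) * mu (P 0%R m) + mu (P d m) * mu (P d m)
             + (err n)%:E * mu (P d m))%E.
apply: (@le_trans _ _ (\sum_(0 <= m <oo) v m)%E); last first.
  rewrite nneseriesD; [|by move=> *; rewrite ?adde_ge0 ?mule_ge0 ?lee_fin..].
  rewrite nneseriesD; [|by move=> *; rewrite ?adde_ge0 ?mule_ge0..].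
  rewrite nneseriesZl// sum1 mule1 leeD2r//.
  rewrite (_ : 2%:E = 1%:E + 1%:E)%E; last by rewrite -EFinD.
  by rewrite ge0_muleDl ?lee_fin// !mul1e; apply: leeD.
apply: (le_trans (measure_sigma_subadditive mu
  (fun m => measurable_near_cell n d m r0) _ _)) => //.
  by apply: bigcup_measurable => m _; exact: measurable_near_cell.
apply: lee_nneseries => // m _.
have [a [b [ab _ Iab]]] := grid_cellE r0 0 m.
have := @mixing_co n a b (grid_cell r d m) ab (measurable_grid_cell r0 _ _).
rewrite -Iab => /le_trans; apply; rewrite leeD2r//.
rewrite -(fineK (fin_num_measure mu _ (mP 0 m))).
rewrite -(fineK (fin_num_measure mu _ (mP d m))).
by rewrite -!EFinM -EFinD lee_fin; nra.
Qed.

(** The shifts -1, 0 and 1 cover the return set; each costs twice the integral plus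
    [3 * K * expR (- (theta * n))]. *)
Lemma measure_Aret_mixing r n : 0 < r ->
  (mu (Aret X T r n) <= 6%:E * \int[mu]_(x in X) mu (ball x r) +
    (9 * K * expR (- (theta * n%:R)))%:E)%E.
Proof.
move=> r0; have mnp d : measurable (near_pair r n d).
  by apply: bigcup_measurable => m _; exact: measurable_near_cell.
apply: (@le_trans _ _
  (mu (near_pair r n (-1) `|` near_pair r n 0 `|` near_pair r n 1))).
  apply: le_measure; rewrite ?inE; first exact: measurable_Aret.
    by do 2?apply: measurableU.
  move=> x [Xx /(grid_cell_close r0) [m]].
  by case=> -[h1 h2]; [left; left|left; right|right]; exists m.
apply: (le_trans (measureU2 mu (measurableU _ _ (mnp _) (mnp _)) (mnp _))).
apply: (le_trans (leeD (measureU2 mu (mnp _) (mnp _)) (lexx _))).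
apply: (le_trans (leeD (leeD (measure_near_pair _ _ r0)
  (measure_near_pair _ _ r0)) (measure_near_pair _ _ r0))).
set I := (\int[mu]_(_ in _) _)%E.
have I0 : (0 <= I)%E by exact: integral_ge0.
rewrite [leLHS](_ : _ = (2%:E * I + 2%:E * I + 2%:E * I) +
  ((err n)%:E + (err n)%:E + (err n)%:E))%E; last first.
  by rewrite [X in (X + _ = _)%E]addeACA [LHS]addeACA.
rewrite -!ge0_muleDl ?lee_fin// -!EFinD /err.
rewrite (_ : 2 + 2 + 2 = 6 :> R); last by lra.
by rewrite leeD2l// lee_fin; lra.
Qed.

End dynamics.

(** * Counting, null limit inferior and radius bounds *)

(** At most [y] integers satisfy [0 < k <= y]; leaving out [k = 0] keeps this true for [y < 1]. *)
Lemma sum_if_le_mul (R : realType) (y c : R) n : 0 <= y -> 0 <= c ->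
  \sum_(k < n | (0 < k)%N) (if k%:R <= y then c else 0) <= y * c.
Proof.
move=> y0 c0; case: n => [|n]; first by rewrite big_ord0 mulr_ge0.
(* The bound by [n%:R * c] carries the induction: a nonzero new term means [n.+1%:R <= y], and then
   [n.+1%:R * c <= y * c]. *)
suff [] : \sum_(k < n.+1 | (0 < k)%N) (if k%:R <= y then c else 0) <= n%:R * c /\
  \sum_(k < n.+1 | (0 < k)%N) (if k%:R <= y then c else 0) <= y * c by [].
elim: n => [|n [IH1 IH2]].
  by rewrite big_mkcond big_ord1/= mul0r mulr_ge0.
rewrite big_mkcond big_ord_recr/= -big_mkcond/=.
have nc : n.+1%:R * c = n%:R * c + c by rewrite -natr1 mulrDl mul1r.
split; first by rewrite nc lerD//; case: ifP.
case: ifP => ny; last by rewrite addr0.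
by rewrite (le_trans _ (ler_wpM2r c0 ny))// nc lerD2r.
Qed.

(** Each tail intersection lies in all later [F n], hence is null, and the limit inferior is a
    countable union of them. *)
Lemma measure_liminf_set0 (R : realType) (mu : probability R R) (F : nat -> set R) :
  (forall n, measurable (F n)) ->
  (forall e : R, 0 < e -> \forall n \near \oo, (mu (F n) <= e%:E)%E) ->
  mu (liminf_set F) = 0%E.
Proof.
move=> mF smallF.
pose G N := \bigcap_(n in [set k | (N <= k)%N]) F n.
have mG N : measurable (G N) by exact: bigcap_measurableType.
have G0 N : mu (G N) = 0%E.
  apply/eqP; rewrite eq_le measure_ge0 andbT; apply/lee_addgt0Pr => e e0.
  rewrite add0e; near \oo => n; apply: (@le_trans _ _ (mu (F n))).
    apply: le_measure; rewrite ?inE// => x; apply; rewrite /=.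
    by near: n; exact: nbhs_infty_ge.
  by near: n; exact: smallF.
apply/eqP; rewrite eq_le measure_ge0 andbT.
apply: (le_trans (measure_sigma_subadditive mu mG _ _)) => //.
  exact: bigcupT_measurable.
by rewrite eseries0// => N _ _; exact: G0.
Unshelve. all: by end_near. Qed.

Lemma powR_radius_bound (R : realType) (Q s r h : R) : 0 < Q -> 0 < s -> 0 < h -> 0 < r ->
  r <= 1 / (Q `^ (1 / s) * h) -> Q * r `^ s <= (h `^ s)^-1.
Proof.
move=> Q0 s0 h0 r0.
have Qs0 : 0 < Q `^ (1 / s) by exact: powR_gt0.
rewrite ler_pdivlMr ?mulr_gt0// => rQh.
rewrite -[leRHS]mul1r ler_pdivlMr ?powR_gt0//.
have <- : (r * (Q `^ (1 / s) * h)) `^ s = Q * r `^ s * h `^ s.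
  rewrite !powRM ?(ltW r0) ?(ltW h0) ?mulr_ge0 ?(ltW h0) ?(ltW Qs0)//.
  by rewrite -powRrM div1r mulVf ?gt_eqF// powRr1 ?(ltW Q0)//; ring.
have one : 1 `^ s = 1 :> R by rewrite powR1.
rewrite -[leRHS]one; apply: ge0_ler_powR; rewrite ?nnegrE ?(ltW s0)//.
by rewrite !mulr_ge0 ?(ltW r0) ?(ltW h0) ?(ltW Qs0).
Qed.

(** * Choice of the cutoff and final estimate *)

Theorem mainTheorem12 (R : realType) (X : set R) (T : R -> R)
  (mu : probability R R)
  (hXint : is_interval X) (hXmeas : measurable X) (hmuX : mu X = 1%E)
  (hTX : forall x, X x -> X (T x)) (hTmeas : measurable_fun X T)
  (hinv : forall A, measurable A -> A `<=` X -> mu (X `&` T @^-1` A) = mu A)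
  (hmix : exists C theta : R, 0 < C /\ 0 < theta /\
     forall (psi phi : R -> R) (n : nat),
       measurable_fun X psi -> (bvnorm X psi < +oo)%E ->
       mu.-integrable X (EFin \o phi) ->
       `| Rintegral mu X (fun x => psi x * phi (iter n T x))
          - Rintegral mu X psi * Rintegral mu X phi |
       <= C * fine (bvnorm X psi) * Rintegral mu X (fun x => `|phi x|)
            * expR (- (theta * n%:R)))
  (C s : R) (hC : 0 < C) (hs : 0 < s)
  (hsrt : forall (r : R) (n : nat), 0 < r -> (1 <= n)%N ->
     (mu (Aret X T r n) <= (C * r `^ s)%:E)%E)
  (rn : nat -> R) (h : nat -> R)
  (hrpos : forall n, 0 < rn n) (hhpos : forall n, 0 < h n)
  (hhinf : h @ \oo --> +oo)
  (hev : \forall n \near \oo,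
     rn n <= 1 / ((n%:R * ln n%:R) `^ (1 / s) * h n) /\
     (\int[mu]_(x in X) mu (ball x (rn n)) <= (1 / (n%:R ^+ 2 * h n))%:E)%E) :
  mu (liminf_set (fun n => Fset X T n (rn n))) = 0%E.
Proof.
have [K [theta [K0 [theta0 mix]]]] := hmix.
apply: measure_liminf_set0 => [n|e e0]; first exact: measurable_Fset.
(* For [k > kap * ln n] the mixing error [expR (- (theta * k))] is below [n ^- 3], which beats the
   factor [n ^ 2] from the sums over [i] and [k]. *)
pose kap := 3 / theta.
have kap0 : 0 < kap by rewrite divr_gt0.
have e30 : 0 < e / 3 by rewrite divr_gt0.
near=> n.
have n3 : 3 <= n%:R :> R by near: n; exact: nbhs_infty_ger.
have [rnle Ile] : rn n <= 1 / ((n%:R * ln n%:R) `^ (1 / s) * h n) /\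
     (\int[mu]_(x in X) mu (ball x (rn n)) <= (1 / (n%:R ^+ 2 * h n))%:E)%E.
  by near: n; exact: hev.
have hn1 : (kap * C / (e / 3)) `^ (1 / s) <= h n.
  by near: n; move/cvgryPge : hhinf; exact.
have hn2 : 6 / (e / 3) <= h n by near: n; move/cvgryPge : hhinf; exact.
have n4 : 9 * K / (e / 3) <= n%:R by near: n; exact: nbhs_infty_ger.
have n0 : 0 < n%:R :> R by lra.
have ln0 : 0 < ln n%:R :> R by rewrite ln_gt0//; lra.
have hn0 := hhpos n.
pose short := C * rn n `^ s.
pose long := 6 * (1 / (n%:R ^+ 2 * h n)) + 9 * K * n%:R ^- 3.
have short0 : 0 <= short by rewrite mulr_ge0 ?powR_ge0// ltW.
have long0 : 0 <= long.
  by rewrite addr_ge0// !mulr_ge0// ?invr_ge0 ?mulr_ge0 ?exprn_ge0// ltW.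
(* Adding [long] for every [k] lets one sequence dominate both ranges of [k], at a total cost of at
   most [n * long]. *)
pose a k := (if k%:R <= kap * ln n%:R then short else 0) + long.
have muF : (mu (Fset X T n (rn n)) <= (n%:R * \sum_(k < n | (0 < k)%N) a k)%:E)%E.
  apply: measure_Fset_le => // k.
    by rewrite addr_ge0//; case: ifP.
  move=> k0; rewrite /a; case: ifPn => [_|].
    by rewrite (le_trans (hsrt _ _ _ _))// lee_fin lerDl.
  rewrite -ltNge => kbig.
  rewrite add0r (le_trans (measure_Aret_mixing hXmeas hTX hTmeas hmuX K0 mix _ _))//.
  rewrite /long [leRHS]EFinD; apply: leeD.
    by rewrite [leRHS]EFinM lee_wpmul2l// lee_fin.
  rewrite lee_fin.
  rewrite ler_pM2l ?mulr_gt0//.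
  (* Taking logarithms leaves [3 * ln n <= theta * k], which is the choice of [kap]. *)
  rewrite -[leRHS]lnK ?posrE ?invr_gt0 ?exprn_gt0// ler_expR.
  rewrite lnV ?posrE ?exprn_gt0// lerN2 lnXn//.
  rewrite -[leLHS]mulr_natl [leRHS]mulrC -ler_pdivrMr// mulrAC.
  exact: ltW.
rewrite (le_trans muF)// lee_fin.
have sumle : \sum_(k < n | (0 < k)%N) a k <= kap * ln n%:R * short + n%:R * long.
  rewrite big_split/= lerD//.
    by apply: sum_if_le_mul => //; rewrite mulr_ge0 ?ltW.
  rewrite mulr_natl -[n in _ *+ n]card_ord -sumr_const [leLHS]big_mkcond/=.
  by apply: ler_sum => k _; case: ifP.
rewrite (le_trans (ler_wpM2l (ltW n0) sumle))//.
have Q0 : 0 < n%:R * ln n%:R :> R by rewrite mulr_gt0.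
have Qr := powR_radius_bound Q0 hs hn0 (hrpos n) rnle.
(* The factor [n ^ 2] in front of [long] cancels [n ^ 2] in the integral bound and leaves [1 / n]
   from [n ^- 3]; in the short range [n * ln n] appears, as [Qr] requires. *)
have -> : n%:R * (kap * ln n%:R * short + n%:R * long) =
    kap * C * (n%:R * ln n%:R * rn n `^ s) + 6 / h n + 9 * K / n%:R.
  rewrite /short /long; clear -n0 hn0; move: n%:R n0 => x x0; clearbody kap.
  by field; rewrite !gt_eqF.
rewrite (_ : e = e / 3 + e / 3 + e / 3); last by field.
have kC0 : 0 < kap * C by rewrite mulr_gt0.
rewrite !lerD//.
- rewrite (le_trans (ler_wpM2l (ltW kC0) Qr))// ler_pdivrMr ?powR_gt0//.
  rewrite [leRHS]mulrC -ler_pdivrMr//.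
  have E0 : 0 < kap * C / (e / 3) by rewrite divr_gt0.
  have E0s : (kap * C / (e / 3)) `^ (1 / s) \is Num.nneg by rewrite nnegrE powR_ge0.
  have h0 : h n \is Num.nneg by rewrite nnegrE ltW.
  have := ge0_ler_powR (ltW hs) E0s h0 hn1.
  by rewrite -powRrM div1r mulVf ?gt_eqF// powRr1 ?(ltW E0).
- by rewrite ler_pdivrMr// [leRHS]mulrC -ler_pdivrMr.
- by rewrite ler_pdivrMr// [leRHS]mulrC -ler_pdivrMr.
Unshelve. all: by end_near. Qed.
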